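(* If $F$ is the limit set of a conformal iterated function system (CIFS), then the function $\theta\mapsto\dim_{\mathrm A}^\theta F$ is increasing in $\theta\in(0,1)$, i.e. $\dim_{\mathrm A}^\theta F\le\dim_{\mathrm A}^\phi F$ whenever $0<\theta<\phi<1$.
   Context: Notation: $\mathbb{N}=\{1,2,3,\dots\}$; $B(x,r)$ is the open Euclidean ball; $\mathcal{L}^d$ is Lebesgue measure; $N_r(E)$ is the smallest number of balls of radius $r$ needed to cover $E$. CIFS: Let $d\in\mathbb{N}$, let $X$ be a compact connected subset of $\mathbb{R}^d$, let $I$ be a (non-empty) countable index set (finite or infinite), and let $S_i:X\to X$, $i\in I$. Put $I^*=\bigcup_{n\ge1}I^n$ (finite words), and for $w=w_1\cdots w_n\in I^n$ put $S_w=S_{w_1}\circ\cdots\circ S_{w_n}$. The system is a CIFS if: (1) (Open Set Condition) $U:=\mathrm{Int}_{\mathbb{R}^d}X\neq\varnothing$, $S_i(U)\subset U$ for all $i$, and $S_i(U)\cap S_j(U)=\varnothing$ for $i\ne j$; (2) (Cone condition) $\inf_{x\in X}\inf_{r\in(0,1)}\mathcal{L}^d(B(x,r)\cap \mathrm{Int}_{\mathbb{R}^d}X)/r^d>0$; (3) (Conformality) there is an open, bounded, connected $V\subset\mathbb{R}^d$ with $X\subset V$ and $\epsilon>0$ such that each $S_i$ extends to a $C^{1+\epsilon}$ diffeomorphism $\overline{S_i}$ from $V$ onto an open subset of $V$, which is conformal on $V$: for all $x\in V$ the differential $\overline{S_i}'|_x$ exists, is non-zero, is a similarity map ($\|\overline{S_i}'|_x(y)\|=\|\overline{S_i}'|_x\|\,\|y\|$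 for all $y\in\mathbb{R}^d$), and is $\epsilon$-Hölder continuous in $x$. Moreover there is $\xi\in(0,1)$ with $\|\overline{S_i}'\|<\xi$ for all $i\in I$, where $\|\cdot\|$ is the supremum norm over $V$; (4) (Bounded distortion) there is $K>0$ with $\|S_w'|_y\|\le K\|S_w'|_x\|$ for all $x,y\in V$, $w\in I^*$ (derivatives of the composed extensions). The limit set is $F=\bigcup_{w\in I^{\mathbb{N}}}\bigcap_{n\ge1}S_{w|_n}(X)$, where $w|_n=w_1\cdots w_n$. For a non-empty bounded set $E\subset\mathbb{R}^d$ and $\theta\in(0,1)$, the Assouad spectrum is $\dim_{\mathrm A}^\theta E=\inf\{\alpha:\exists C>0\ \forall x\in E\ \forall\,0<R\le1,\ N_{R^{1/\theta}}(B(x,R)\cap E)\le CR^{\alpha(1-1/\theta)}\}$. *)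

(* Defs.v *)
From HB Require Import structures.
From mathcomp Require Import all_boot all_order all_algebra.
From mathcomp Require Import all_classical all_reals all_analysis.

Set Implicit Arguments.
Unset Strict Implicit.
Unset Printing Implicit Defensive.

Import Order.TTheory GRing.Theory Num.Theory.
Import numFieldNormedType.Exports.

Local Open Scope classical_set_scope.
Local Open Scope ring_scope.

(* The library's norm and balls on 'rV[R]_d are those of the max norm, so the
   Euclidean ones are defined here. Open, compact, connected and bounded sets,
   interiors and differentials do not depend on which of the two norms is used
   and are taken from the library. *)
Section Euclidean.
Context {R : realType} {d : nat}.
Implicit Types (x y : 'rV[R]_d) (A E : set 'rV[R]_d) (r : R).

Definition enorm x : R := Num.sqrt (\sum_(i < d) x 0 i ^+ 2).

Definition eball x r : set 'rV[R]_d := [set y | enorm (y - x) < r].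

(* Operator norm; the supremum is over a bounded set when L is linear. *)
Definition opnorm (L : 'rV[R]_d -> 'rV[R]_d) : R :=
  sup [set enorm (L y) | y in [set y | enorm y <= 1]].

Definition open_box (a b : 'rV[R]_d) : set 'rV[R]_d :=
  [set x | forall i, a 0 i < x 0 i < b 0 i].

(* Lebesgue outer measure, by countable covers with boxes; on measurable sets,
   in particular on open sets, it is d-dimensional Lebesgue measure. *)
Definition lebesgue_rV A : \bar R :=
  ereal_inf [set (\sum_(0 <= k <oo) (\prod_(i < d) (ab.2 k 0 i - ab.1 k 0 i))%:E)%E
            | ab in [set ab : (nat -> 'rV[R]_d) * (nat -> 'rV[R]_d) |
                (forall k i, ab.1 k 0 i <= ab.2 k 0 i) /\
                A `<=` \bigcup_k open_box (ab.1 k) (ab.2 k)]].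

(* The centres need not lie in E; the value is +oo if no finite cover exists. *)
Definition covering_number r E : \bar R :=
  ereal_inf [set (n%:R)%:E | n in [set n : nat |
    exists c : 'I_n -> 'rV[R]_d, E `<=` \bigcup_(i : 'I_n) eball (c i) r]].

Definition assouad_spectrum (theta : R) E : \bar R :=
  ereal_inf [set alpha%:E | alpha in [set alpha : R |
    exists2 C : R, 0 < C & forall x, E x -> forall rho : R, 0 < rho <= 1 ->
      (covering_number (rho `^ (1 / theta)) (eball x rho `&` E)
       <= (C * rho `^ (alpha * (1 - 1 / theta)))%:E)%E]].

End Euclidean.

Section Smoothness.
Context {R : realType} {d : nat}.
Implicit Types (f : 'rV[R]_d -> 'rV[R]_d) (A V W : set 'rV[R]_d) (eps : R).

Definition holder_diff eps f A : Prop :=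
  exists C : R, forall x y, A x -> A y ->
    opnorm (fun v => 'd f x v - 'd f y v) <= C * enorm (x - y) `^ eps.

(* Class C^{1+eps} on an open set: the Hoelder condition is local, as usual;
   the uniform one on V is a separate clause of conformal_on. *)
Definition C1eps_on eps f A : Prop :=
  (forall x, A x -> differentiable f x) /\
  (forall x, A x -> exists2 N, nbhs x N & holder_diff eps f (A `&` N)).

Definition C1eps_diffeo eps f V W : Prop :=
  [/\ f @` V = W, C1eps_on eps f V &
      exists2 g : 'rV[R]_d -> 'rV[R]_d,
        (forall x, V x -> g (f x) = x) & C1eps_on eps g W].

Definition conformal_on eps f V : Prop :=
  [/\ forall x, V x -> differentiable f x,
      forall x, V x -> ('d f x : 'rV[R]_d -> 'rV[R]_d) <> (fun=> 0),
      forall x, V x -> forall y,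
        enorm ('d f x y) = opnorm ('d f x) * enorm y &
      holder_diff eps f V].

End Smoothness.

Section Systems.
Context {R : realType} {d : nat} {I : Type}.
Implicit Types (X V : set 'rV[R]_d) (S : I -> 'rV[R]_d -> 'rV[R]_d).

Definition word_map S (w : seq I) : 'rV[R]_d -> 'rV[R]_d :=
  foldr (fun i f => S i \o f) id w.

Definition limit_set X S : set 'rV[R]_d :=
  \bigcup_(w in [set: nat -> I])
    \bigcap_(n in [set n : nat | (1 <= n)%N]) (word_map S (mkseq w n) @` X).

Definition open_set_condition X S : Prop :=
  [/\ X° !=set0,
      forall i, S i @` X° `<=` X° &
      forall i j, i <> j -> S i @` X° `&` S j @` X° = set0].

Definition cone_condition X : Prop :=
  (0 < ereal_inf [set ereal_inf
         [set lebesgue_rV (eball x r `&` X°) * ((r ^+ d)^-1)%:E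
         | r in [set r : R | (0 < r < 1)%R]] | x in X])%E.

Definition conformality X S V (eps : R) (Sbar : I -> 'rV[R]_d -> 'rV[R]_d) :
    Prop :=
  [/\ [/\ open V, bounded_set V, connected V & X `<=` V],
      0 < eps,
      forall i,
        [/\ forall x, X x -> Sbar i x = S i x,
            open (Sbar i @` V),
            Sbar i @` V `<=` V,
            C1eps_diffeo eps (Sbar i) V (Sbar i @` V) &
            conformal_on eps (Sbar i) V] &
      exists2 xi : R, 0 < xi < 1 & forall i,
        (ereal_sup [set (opnorm ('d (Sbar i) x))%:E | x in V] < xi%:E)%E].

Definition bounded_distortion V (Sbar : I -> 'rV[R]_d -> 'rV[R]_d) : Prop :=
  exists2 K : R, 0 < K & forall w : seq I, (1 <= size w)%N ->
    forall x y, V x -> V y ->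
      opnorm ('d (word_map Sbar w) y) <= K * opnorm ('d (word_map Sbar w) x).

(* The maps S i : X -> X are represented by total functions whose values
   outside X are irrelevant. *)
Record CIFS X S : Prop := {
  cifs_dim : (1 <= d)%N ;
  cifs_compact : compact X ;
  cifs_connected : connected X ;
  cifs_index_nonempty : [set: I] !=set0 ;
  cifs_index_countable : countable [set: I] ;
  cifs_maps : forall i x, X x -> X (S i x) ;
  cifs_osc : open_set_condition X S ;
  cifs_cone : cone_condition X ;
  cifs_conformal : exists (V : set 'rV[R]_d) (eps : R)
      (Sbar : I -> 'rV[R]_d -> 'rV[R]_d),
    conformality X S V eps Sbar /\ bounded_distortion V Sbar }.

End Systems.

(* Main.v *)
(* Only one map f of the system is needed. Put a_n(x) = prod_(k < n) |f'(f^k x)|.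
   Hoelder continuity of f' and contraction make f^n bi-Lipschitz with ratio
   comparable to a_n(x) on a ball of fixed radius around x, uniformly in n and x,
   and the numbers a_n(x) go to 0 with consecutive ratios bounded below. Hence
   B(x,rho) and F can be blown down by f^n into B(f^n x, rho') and F for
   essentially any rho' <= rho. With rho' chosen so that rho'^(1/phi) / rho' is a
   fixed multiple of rho^(1/theta) / rho, a cover of the image at scale
   rho'^(1/phi) pulls back to a cover at scale rho^(1/theta), and
   rho'^(1 - 1/phi) is a fixed multiple of rho^(1 - 1/theta), so every exponent
   admissible for phi is admissible for theta. *)
From HB Require Import structures.
Require Import Defs.
From mathcomp Require Import all_boot all_order all_algebra.
From mathcomp Require Import all_classical all_reals all_analysis.
From mathcomp Require Import ring lra.

Import Order.TTheory GRing.Theory Num.Theory.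
Import numFieldNormedType.Exports.

Local Open Scope classical_set_scope.
Local Open Scope ring_scope.

(** * The Euclidean norm and its comparison with the max norm *)

Section EuclideanNorm.
Context {R : realType} {d : nat}.
Implicit Types (u v w : 'rV[R]_d).

Definition dotr u v : R := \sum_(i < d) u 0 i * v 0 i.

Lemma enorm_ge0 v : 0 <= enorm v.
Proof. exact: sqrtr_ge0. Qed.

Lemma dotrr v : dotr v v = enorm v ^+ 2.
Proof.
rewrite /enorm sqr_sqrtr; last by apply: sumr_ge0 => i _; rewrite sqr_ge0.
by apply: eq_bigr => i _; rewrite expr2.
Qed.

Lemma dotrC u v : dotr u v = dotr v u.
Proof. by apply: eq_bigr => i _; rewrite mulrC. Qed.

Lemma dotr_is_linear u : linear (dotr u : 'rV[R]_d -> R^o).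
Proof.
move=> k v w; rewrite /dotr scaler_sumr -big_split; apply: eq_bigr => i _.
by rewrite !mxE mulrDr /GRing.scale/= mulrCA.
Qed.

HB.instance Definition _ u :=
  GRing.isLinear.Build R 'rV[R]_d R^o _ (dotr u) (dotr_is_linear u).

Lemma dotrDr u v w : dotr u (v + w) = dotr u v + dotr u w.
Proof. exact: linearD. Qed.

Lemma dotrBr u v w : dotr u (v - w) = dotr u v - dotr u w.
Proof. exact: linearB. Qed.

Lemma dotrZr u (k : R) v : dotr u (k *: v) = k * dotr u v.
Proof. exact: linearZ. Qed.

Lemma dotr_continuous u : continuous (dotr u : 'rV[R]_d -> R^o).
Proof.
move=> v; rewrite /continuous_at /dotr.
refine (@cvg_big R^o _ +%R _ xpredT add_continuous _ (nbhs v) _ _ _ _ _).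
move=> i _; have vi := @coord_continuous R 1 d 0 i v.
exact: cvgMl_tmp vi.
Qed.

Lemma enormZ (k : R) v : enorm (k *: v) = `|k| * enorm v.
Proof.
rewrite /enorm -sqrtr_sqr -sqrtrM ?sqr_ge0// mulr_sumr.
by congr Num.sqrt; apply: eq_bigr => i _; rewrite mxE exprMn.
Qed.

Lemma enormN v : enorm (- v) = enorm v.
Proof. by rewrite -scaleN1r enormZ normrN1 mul1r. Qed.

Lemma enormBC u v : enorm (u - v) = enorm (v - u).
Proof. by rewrite -enormN opprB. Qed.

Lemma enorm0 : enorm (0 : 'rV[R]_d) = 0.
Proof. by rewrite -(scale0r (0 : 'rV[R]_d)) enormZ normr0 mul0r. Qed.

Lemma ler_norm_enorm v : `|v| <= enorm v.
Proof.
rewrite [`|v|]/Num.norm /= mx_normrE; apply: bigmax_le => [|[i j] _ /=].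
  exact: enorm_ge0.
rewrite ord1 -sqrtr_sqr ler_wsqrtr// (bigD1 j)//= lerDl.
by apply: sumr_ge0 => k _; rewrite sqr_ge0.
Qed.

Lemma enorm_eq0 v : enorm v = 0 -> v = 0.
Proof.
move=> v0; apply/eqP; rewrite -normr_le0.
by apply: (le_trans (ler_norm_enorm v)); rewrite v0.
Qed.

(** With [a], [b] the norms of [u], [v], the squared norm of [b *: u - a *: v] expands to
    [2 * (a * b) * (a * b - dotr u v)]. *)
Lemma cauchy_schwarz u v : dotr u v <= enorm u * enorm v.
Proof.
set a := enorm u; set b := enorm v.
have [a0|a0] := eqVneq a 0.
  by rewrite a0 mul0r (enorm_eq0 u a0) dotrC -(scale0r v) dotrZr mul0r.
have [b0|b0] := eqVneq b 0.
  by rewrite b0 mulr0 (enorm_eq0 v b0) -(scale0r u) dotrZr mul0r.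
have ab : 0 < a * b by rewrite lt0r mulf_neq0//= mulr_ge0 ?enorm_ge0.
have : 0 <= dotr (b *: u - a *: v) (b *: u - a *: v).
  by rewrite dotrr sqr_ge0.
rewrite dotrBr !dotrZr ![dotr (_ - _) _]dotrC !dotrBr !dotrZr !dotrr.
rewrite -/a -/b [dotr v u]dotrC.
rewrite -[in X in _ -> X]subr_ge0 -(pmulr_rge0 _ ab).
by nra.
Qed.

Lemma ler_enormD u v : enorm (u + v) <= enorm u + enorm v.
Proof.
rewrite -ler_sqr ?nnegrE ?addr_ge0 ?enorm_ge0// -dotrr.
rewrite dotrDr ![dotr (_ + _) _]dotrC !dotrDr !dotrr [dotr v u]dotrC.
by rewrite sqrrD; have := cauchy_schwarz u v; lra.
Qed.

Lemma ler_enormB u v : enorm (u - v) <= enorm u + enorm v.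
Proof. by rewrite -(enormN v) ler_enormD. Qed.

Lemma ler_enorm_dist u v w : enorm (u - w) <= enorm (u - v) + enorm (v - w).
Proof. by have := ler_enormD (u - v) (v - w); rewrite addrA subrK. Qed.

(** The sharp factor is the square root of [d]; the cruder [d] suffices, since only the equivalence
    of the two norms matters. *)
Lemma ler_enorm_norm v : enorm v <= d%:R * `|v|.
Proof.
have nv i : `|v 0 i| <= `|v|.
  rewrite [`|v|]/Num.norm/= mx_normrE.
  exact: (le_bigmax _ (fun ij : 'I_1 * 'I_d => `|v ij.1 ij.2|) (0, i)).
rewrite -(ger0_norm (mulr_ge0 (ler0n _ d) (normr_ge0 v))) -sqrtr_sqr.
apply: ler_wsqrtr; rewrite exprMn.
apply: (@le_trans _ _ (\sum_(i < d) `|v| ^+ 2)).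
  apply: ler_sum => i _; rewrite -real_normK ?num_real//.
  by rewrite ler_sqr ?nnegrE.
rewrite sumr_const card_ord -[leLHS]mulr_natl ler_wpM2r ?sqr_ge0//.
by rewrite -natrX ler_nat; case: (d) => // n; rewrite leq_pmulr.
Qed.

Lemma subset_ball_eball v (r : R) : 0 < r ->
  ball v (r / d.+1%:R) `<=` eball v r.
Proof.
move=> r0 w; rewrite -ball_normE /ball_ /= distrC /eball => vw.
apply: (le_lt_trans (ler_enorm_norm _)).
apply: (@le_lt_trans _ _ (d.+1%:R * `|w - v|)).
  by rewrite ler_wpM2r// ler_nat.
by rewrite mulrC -ltr_pdivlMr.
Qed.

Lemma subset_eball_ball v (r : R) : eball v r `<=` ball v r.
Proof.
move=> w; rewrite -ball_normE /ball_ /= distrC => vw.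
exact: le_lt_trans (ler_norm_enorm _) vw.
Qed.

End EuclideanNorm.

(** * Compactness arguments and a mean value inequality *)

Section CompactSets.
Context {R : realType} {d : nat}.
Implicit Types (X V : set 'rV[R]_d).

(** If the [e]-ball around [x] lies in [V], radii up to [e / 2] work for all centres within [e / 2]
    of [x]; compactness makes this local uniformity global. *)
Lemma compact_eball_subset X V : compact X -> open V -> X `<=` V ->
  exists2 r : R, 0 < r & forall x, X x -> eball x r `<=` V.
Proof.
move=> cX oV XV.
have nearV x : X x -> \forall x' \near x & r \near 0^'+, eball x' r `<=` V.
  move=> Xx; have /nbhs_ballP[e/= e0 eV] : nbhs x V.
    by apply: open_nbhs_nbhs; split=> //; exact: XV.
  near=> x' r => y /subset_eball_ball x'y; apply: eV.
  have re : r <= e / 2 by near: r; apply: nbhs_right_le; rewrite divr_gt0.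
  rewrite (splitr e); apply: (@ball_triangle _ _ x').
    by near: x'; apply: nbhsx_ballx; rewrite divr_gt0.
  exact: le_ball x'y.
have : \forall r \near 0^'+, X `<=` (fun x => eball x r `<=` V).
  exact: (compact_near_coveringP X).1.
move=> XrV; have : \forall r \near (0 : R)^'+, 0 < r /\ X `<=` (fun x => eball x r `<=` V).
  by near=> r; split; near: r => //; exact: nbhs_right_gt.
by move=> /filter_ex[r [r0 rV]]; exists r.
Unshelve. all: by end_near. Qed.

Lemma compact_finite_cover X (r : R) : compact X -> 0 < r ->
  exists n (c : 'I_n -> 'rV[R]_d), X `<=` \bigcup_(i : 'I_n) eball (c i) r.
Proof.
rewrite compact_cover => cX r0.
have [|x Xx|D _ XD] := cX 'rV[R]_d X (fun x => (ball x (r / d.+1%:R))^°).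
- by move=> i _; exact: open_interior.
- by exists x => //; apply: nbhsx_ballx; rewrite divr_gt0.
- exists (size (finmap.enum_fset D)), (fun i => nth 0 (finmap.enum_fset D) i) => x /XD[c /= cD cx].
  have iD : (index c (finmap.enum_fset D) < size (finmap.enum_fset D))%N by rewrite index_mem.
  exists (Ordinal iD) => //=; rewrite nth_index//.
  by apply: subset_ball_eball => //; exact: interior_subset cx.
Qed.

End CompactSets.

(** The scalar mean value theorem is applied to [f] along the segment, tested against the error
    vector [w] itself. This gives [enorm w ^+ 2 <= enorm w * M]. Taking [l = 0] yields a Lipschitz
    bound, taking for [l] a derivative at a fixed point yields a linearization error. *)
Lemma enorm_mean_value {R : realType} {d : nat} (f : 'rV[R]_d -> 'rV[R]_d)
    (y z l : 'rV[R]_d) (M : R) :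
  (forall t : R, 0 <= t <= 1 ->
     differentiable f (y + t *: (z - y)) /\
     enorm ('d f (y + t *: (z - y)) (z - y) - l) <= M) ->
  enorm (f z - f y - l) <= M.
Proof.
move=> fM; set w : 'rV[R]_d := f z - f y - l; set v : 'rV[R]_d := z - y.
pose c (t : R) : 'rV[R]_d := y + t *: v.
pose h (t : R) : R := dotr w (f (c t)).
have hd (t : R) : 0 <= t <= 1 -> is_derive t 1 h (dotr w ('d f (c t) v)).
  move=> t01; have [fd _] := fM t t01.
  have cd : is_diff t c ( *:%R^~ v).
    by apply: (is_diff_eq (is_diffD (is_diff_cst y t) (is_diff_scalel t v))); rewrite add0r.
  have lc := dotr_continuous w.
  have ld : differentiable (dotr w : 'rV[R]_d -> R^o) (f (c t)).
    exact: linear_differentiable.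
  have fcd : differentiable (f \o c) t by apply: differentiable_comp.
  have hd : differentiable (h : R^o -> R^o) t.
    exact: (@differentiable_comp _ _ _ _ (f \o c) (dotr w)).
  split; first exact/derivable1_diffP.
  rewrite deriveE// (@diff_comp _ _ _ _ (f \o c) (dotr w))//=.
  rewrite diff_lin// (@diff_comp _ _ _ _ c f)//=.
  by rewrite diff_val /= scale1r.
have [s s01|s s01|t] := @MVT R h (fun t : R => dotr w ('d f (c t) v)) 0 1 ltr01.
- by apply: hd; move: s01; rewrite in_itv/= => /andP[? ?]; rewrite !ltW.
- apply: derivable_within_continuous => t; rewrite in_itv/= => t01.
  by have [] := hd t t01.
rewrite in_itv/= => /andP[t0 t1].
rewrite /h /c scale1r scale0r addr0 {1}/v subrKC subr0 mulr1 -dotrBr => E.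
have [_ tM] := fM t (introT andP (conj (ltW t0) (ltW t1))).
have : enorm w * enorm w <= enorm w * M.
  rewrite -expr2 -dotrr {2}/w dotrBr E -dotrBr.
  apply: (le_trans (cauchy_schwarz _ _)).
  by rewrite ler_wpM2l ?enorm_ge0.
have [->|w0] := eqVneq (enorm w) 0; first by move=> _; exact: le_trans (enorm_ge0 _) tM.
by rewrite ler_pM2l// lt0r w0 enorm_ge0.
Qed.

(** * Covering numbers and how they pass through maps *)

Section CoveringNumber.
Context {R : realType} {d : nat}.
Implicit Types (E X : set 'rV[R]_d) (r s : R).

Lemma covering_number_transfer r s E E' :
  (forall n (c : 'I_n -> 'rV[R]_d), E' `<=` \bigcup_(i : 'I_n) eball (c i) s ->
     exists c' : 'I_n -> 'rV[R]_d, E `<=` \bigcup_(i : 'I_n) eball (c' i) r) ->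
  (covering_number r E <= covering_number s E')%E.
Proof.
move=> EE'; apply: le_ereal_inf => _ [n [c cE'] <-].
by exists n => //; exact: EE' cE'.
Qed.

Lemma le_covering_number r s E E' : s <= r -> E `<=` E' ->
  (covering_number r E <= covering_number s E')%E.
Proof.
move=> sr EE'; apply: covering_number_transfer => n c cE'.
exists c => x /EE'/cE'[i _ xi]; exists i => //.
exact: lt_le_trans xi sr.
Qed.

Lemma covering_number_compact X r : compact X -> 0 < r ->
  exists n : nat, (covering_number r X <= n%:R%:E)%E.
Proof.
move=> cX r0; have [n [c cn]] := compact_finite_cover X r cX r0.
by exists n; apply: ereal_inf_lbound; exists n => //; exists c.
Qed.

(* A set of diameter less than [r] lies in a ball of radius [r] around any of
   its points, so a cover of the image pulls back to one of the same
   cardinality. *)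
Lemma covering_number_expanding r s E E' (g : 'rV[R]_d -> 'rV[R]_d) :
  (forall y, E y -> E' (g y)) ->
  (forall y z, E y -> E z -> enorm (g y - g z) < 2 * s -> enorm (y - z) < r) ->
  (covering_number r E <= covering_number s E')%E.
Proof.
move=> gE gr; apply: covering_number_transfer => n c cE'.
pose piece i := [set y | E y /\ eball (c i) s (g y)].
(* The default centre [0] occurs only for empty pieces, which have nothing to cover. *)
exists (fun i => xget 0 (piece i)) => y Ey.
have [i _ yi] := cE' _ (gE y Ey); exists i => //.
have [Ez zi] : piece i (xget 0 (piece i)) by apply: (xgetPex 0); exists y.
apply: gr => //; apply: (le_lt_trans (ler_enorm_dist _ (c i) _)).
by rewrite mulr_natl mulr2n ltrD// enormBC.
Qed.

End CoveringNumber.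

(** * Bounded distortion along orbits *)

Section Iterates.
Context {R : realType} {d : nat}.
Implicit Types (X E : set 'rV[R]_d) (T : 'rV[R]_d -> 'rV[R]_d)
  (J : 'rV[R]_d -> R).

(** When [T] is conformal and [J] is the norm of its derivative, the chain rule makes this the norm
    of the derivative of the [n]-th iterate. *)
Definition orbit_prod T J n x : R := \prod_(k < n) J (iter k T x).

Lemma orbit_prodS T J n x :
  orbit_prod T J n.+1 x = orbit_prod T J n x * J (iter n T x).
Proof. by rewrite /orbit_prod big_ord_recr. Qed.

Lemma iter_closed X T n x : (forall y, X y -> X (T y)) -> X x ->
  X (iter n T x).
Proof. by move=> TX Xx; elim: n => //= n; exact: TX. Qed.

(* The per-step relative errors decay geometrically along the orbit, so their
   product stays bounded; [1 + q ^+ n] and [2 - q ^+ n] are telescoping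
   majorants of the partial products. *)
Lemma iter_bilipschitz X T J (m xi eps C delta : R) :
  0 < m -> 0 < xi < 1 -> 0 < eps -> 0 <= C -> 0 < delta ->
  (forall x, X x -> X (T x)) -> (forall x, X x -> m <= J x) ->
  (forall x y, X x -> X y -> enorm (y - x) < delta ->
     enorm (T y - T x) <= xi * enorm (y - x)) ->
  (forall x y z t, X x -> X y -> X z -> t < delta ->
     enorm (y - x) <= t -> enorm (z - x) <= t ->
     `|enorm (T y - T z) - J x * enorm (y - z)|
       <= C * t `^ eps * enorm (y - z)) ->
  exists2 eta : R, 0 < eta & forall x y z, X x -> X y -> X z ->
    enorm (y - x) <= eta -> enorm (z - x) <= eta -> forall n,
    orbit_prod T J n x / 2 * enorm (y - z)
      <= enorm (iter n T y - iter n T z)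
      <= 2 * orbit_prod T J n x * enorm (y - z).
Proof.
move=> m0 /andP[xi0 xi1] eps0 C0 delta0 TX Jm Tc TJ.
set q := xi `^ eps.
have q0 : 0 <= q by exact: powR_ge0.
have q1 : q < 1.
  have := @gt0_ltr_powR R eps eps0 xi 1.
  by rewrite powR1; apply; rewrite ?nnegrE ?ler01 ?ltW.
set c := m * (1 - q) / (2 * (C + 1)).
have c0 : 0 < c by rewrite divr_gt0 ?mulr_gt0 ?subr_gt0// ltr_wpDl.
have Cc : C * c <= m * ((1 - q) / 2).
  have -> : C * c = m * ((1 - q) / 2) * (C / (C + 1)).
    by rewrite /c; field; rewrite gt_eqF// ltr_wpDl.
  rewrite ler_piMr// ?mulr_ge0 ?invr_ge0 ?subr_ge0 ?(ltW m0) ?(ltW q1)//.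
  by rewrite ler_pdivrMr ?mul1r ?lerDl// ltr_wpDl.
pose eta := Num.min (delta / 2) (c `^ (eps^-1)).
have eta0 : 0 < eta by rewrite lt_min divr_gt0// powR_gt0.
have eta_delta : eta < delta.
  by rewrite gt_min ltr_pdivrMr// ltr_pMr// ltr1n.
have eta_c : eta `^ eps <= c.
  apply: (@le_trans _ _ ((c `^ (eps^-1)) `^ eps)).
    by apply: ge0_ler_powR; rewrite ?nnegrE ?powR_ge0 ?(ltW eta0) ?(ltW eps0)// ge_min lexx orbT.
  by rewrite -powRrM mulVf ?gt_eqF// powRr1// ltW.
exists eta => // x y z Xx Xy Xz yx zx.
have J0 k : 0 < J (iter k T x) by exact: lt_le_trans m0 (Jm _ (iter_closed _ _ k _ TX Xx)).
have Oge0 k : 0 <= orbit_prod T J k x by apply: prodr_ge0 => j _; exact: ltW.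
have xik k : xi ^+ k * eta <= eta.
  by rewrite ler_piMl ?(ltW eta0)// exprn_ile1 ?ltW.
have near k w : X w -> enorm (w - x) <= eta ->
    enorm (iter k T w - iter k T x) <= xi ^+ k * eta.
  move=> Xw wx; elim: k => [|k IH]; first by rewrite mul1r.
  rewrite !iterS exprS -mulrA.
  apply: (@le_trans _ _ (xi * enorm (iter k T w - iter k T x))).
    apply: Tc; [exact: iter_closed|exact: iter_closed|].
    by apply: le_lt_trans eta_delta; exact: le_trans (xik k).
  by rewrite ler_pM2l.
suff main n : orbit_prod T J n x * ((1 + q ^+ n) / 2) * enorm (y - z)
      <= enorm (iter n T y - iter n T z)
      <= orbit_prod T J n x * (2 - q ^+ n) * enorm (y - z).
  move=> n; have qn : 0 <= q ^+ n by exact: exprn_ge0.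
  have /andP[lo up] := main n; apply/andP; split.
    apply: le_trans lo; apply: ler_wpM2r; first exact: enorm_ge0.
    by apply: ler_wpM2l => //; lra.
  apply: (le_trans up); apply: ler_wpM2r; first exact: enorm_ge0.
  by rewrite [leRHS]mulrC; apply: ler_wpM2l => //; lra.
elim: n => [|n /andP[lo up]].
  by rewrite /orbit_prod big_ord0 /= expr0; apply/andP; split; lra.
set p := q ^+ n in lo up.
have p0 : 0 <= p by exact: exprn_ge0.
have p1 : p <= 1 by apply: exprn_ile1 => //; exact: ltW.
set D := enorm (y - z) in lo up *.
set Dn := enorm (iter n T y - iter n T z) in lo up.
set a := orbit_prod T J n x in lo up.
set j := J (iter n T x).
have j0 : 0 < j by exact: J0.
have : `|enorm (iter n.+1 T y - iter n.+1 T z) - j * Dn|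
    <= j * ((1 - q) / 2) * p * Dn.
  (* After [n] contractions both points are within [xi ^+ n * eta] of the orbit of [x], and the
     power [eps] turns [xi ^+ n] into [q ^+ n]. *)
  have step := TJ (iter n T x) (iter n T y) (iter n T z) (xi ^+ n * eta)
    (iter_closed _ _ n _ TX Xx) (iter_closed _ _ _ _ TX Xy)
    (iter_closed _ _ n _ TX Xz) (le_lt_trans (xik n) eta_delta)
    (near n y Xy yx) (near n z Xz zx).
  apply: (le_trans step); apply: ler_wpM2r; first exact: enorm_ge0.
  rewrite powRM ?exprn_ge0 ?(ltW xi0) ?(ltW eta0)//.
  have -> : (xi ^+ n) `^ eps = p.
    by rewrite -powR_mulrn ?(ltW xi0)// powRAC powR_mulrn ?powR_ge0.
  rewrite mulrCA [p * _]mulrC; apply: ler_wpM2r => //.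
  apply: (@le_trans _ _ (C * c)); first exact: ler_wpM2l.
  apply: (le_trans Cc); apply: ler_wpM2r; first by lra.
  exact: Jm (iter_closed _ _ n _ TX Xx).
rewrite ler_norml orbit_prodS exprS -/a -/p -/j => /andP[dl du].
have aD : 0 <= a * j * D by rewrite !mulr_ge0 ?enorm_ge0 ?Oge0// ltW.
(* [e0] and [e1] are twice the slack in the telescoping inequalities [(1 + p) * (1 - (1 - q) / 2 *
   p) >= 1 + q * p] and [(2 - p) * (1 + (1 - q) / 2 * p) <= 2 - q * p]. *)
have e0 : 0 <= (1 - q) * p * (1 - p).
  by rewrite !mulr_ge0// subr_ge0// ltW.
have e1 : 0 <= (1 - q) * p * p by rewrite !mulr_ge0// subr_ge0 ltW.
have f1 : 0 <= 1 - (1 - q) / 2 * p.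
  have : (1 - q) * p <= 1 by rewrite -[leRHS]mulr1 ler_pM// ?subr_ge0 ?(ltW q1)//; lra.
  by lra.
have f2 : 0 <= 1 + (1 - q) / 2 * p.
  have : 0 <= (1 - q) * p by rewrite mulr_ge0// subr_ge0 ltW.
  by lra.
apply/andP; split.
  apply: (@le_trans _ _ (j * (1 - (1 - q) / 2 * p) * Dn)); last by lra.
  apply: (@le_trans _ _ (j * (1 - (1 - q) / 2 * p) * (a * ((1 + p) / 2) * D))); last first.
    by apply: ler_wpM2l => //; rewrite mulr_ge0// ltW.
  have := mulr_ge0 aD e0; lra.
apply: (@le_trans _ _ (j * (1 + (1 - q) / 2 * p) * Dn)); first by lra.
apply: (@le_trans _ _ (j * (1 + (1 - q) / 2 * p) * (a * (2 - p) * D))).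
  by apply: ler_wpM2l => //; rewrite mulr_ge0// ltW.
have := mulr_ge0 aD e1; lra.
Qed.

End Iterates.

(** * Conformal maps as approximate similarities *)

Section ConformalMaps.
Context {R : realType} {d : nat}.
Implicit Types (f L : 'rV[R]_d -> 'rV[R]_d) (X V : set 'rV[R]_d).

(** The bound [B] makes the set under the supremum in [opnorm] bounded, so that the supremum is an
    upper bound; normalizing [v] then gives the estimate. *)
Lemma enorm_le_opnorm L (B : R) v : (forall k u, L (k *: u) = k *: L u) ->
  (forall u, enorm (L u) <= B * enorm u) ->
  enorm (L v) <= opnorm L * enorm v.
Proof.
move=> LZ LB; have [v0|v0] := eqVneq (enorm v) 0.
  by apply: (le_trans (LB v)); rewrite v0 !mulr0.
have vgt0 : 0 < enorm v by rewrite lt0r v0 enorm_ge0.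
rewrite -ler_pdivrMr//; apply: sup_ubound.
  exists `|B| => _ [u /= u1 <-]; apply: (le_trans (LB u)).
  apply: (le_trans (ler_norm _)); rewrite normrM (ger0_norm (enorm_ge0 u)).
  by rewrite ler_piMr.
exists ((enorm v)^-1 *: v) => /=.
  by rewrite enormZ ger0_norm ?invr_ge0 ?enorm_ge0// mulVf.
by rewrite LZ enormZ ger0_norm ?invr_ge0 ?enorm_ge0// mulrC.
Qed.

Lemma conformal_opnorm_gt0 (eps : R) f V x : conformal_on eps f V -> V x ->
  0 < opnorm ('d f x).
Proof.
move=> [_ fN0 fsim _] Vx; rewrite ltNge; apply/negP => fx0.
apply: (fN0 x Vx); apply/funext => v; apply: enorm_eq0; apply: le_anti.
by rewrite enorm_ge0 andbT fsim// mulr_le0_ge0// enorm_ge0.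
Qed.

Lemma enorm_segment (x y z : 'rV[R]_d) (t r : R) : 0 <= t <= 1 ->
  enorm (y - x) <= r -> enorm (z - x) <= r ->
  enorm (y + t *: (z - y) - x) <= r.
Proof.
move=> /andP[t0 t1] yx zx.
have -> : y + t *: (z - y) - x = (1 - t) *: (y - x) + t *: (z - x).
  by apply/rowP => i; rewrite !mxE; ring.
apply: (le_trans (ler_enormD _ _)); rewrite !enormZ !ger0_norm ?subr_ge0//.
have -> : r = (1 - t) * r + t * r by ring.
by rewrite lerD// ler_wpM2l// subr_ge0.
Qed.

Lemma conformal_lipschitz (eps xi : R) f V x y : conformal_on eps f V ->
  (forall u, V u -> opnorm ('d f u) <= xi) ->
  (forall t, 0 <= t <= 1 -> V (x + t *: (y - x))) ->
  enorm (f y - f x) <= xi * enorm (y - x).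
Proof.
move=> [fd _ fsim _] fxi Vxy; rewrite -[f y - f x]subr0.
apply: enorm_mean_value => t t01; split; first exact/fd/Vxy.
by rewrite subr0 fsim; [rewrite ler_wpM2r ?enorm_ge0//; exact/fxi/Vxy|exact: Vxy].
Qed.

Lemma conformal_almost_similar (eps : R) f V : 0 < eps -> conformal_on eps f V ->
  exists2 C : R, 0 <= C & forall x y z t,
    (forall u, enorm (u - x) <= t -> V u) ->
    enorm (y - x) <= t -> enorm (z - x) <= t ->
    `|enorm (f y - f z) - opnorm ('d f x) * enorm (y - z)|
      <= C * t `^ eps * enorm (y - z).
Proof.
move=> eps0 [fd _ fsim [C0 fC]]; exists `|C0| => // x y z t Vx yx zx.
have t0 : 0 <= t := le_trans (enorm_ge0 _) yx.
have Vxx : V x by apply: Vx; rewrite subrr enorm0.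
have main : enorm (f y - f z - 'd f x (y - z)) <= `|C0| * t `^ eps * enorm (y - z).
  apply: enorm_mean_value => s s01; set u := z + s *: (y - z).
  have ux : enorm (u - x) <= t by exact: enorm_segment.
  have Vu := Vx u ux; split; first exact: fd.
  pose L v := 'd f u v - 'd f x v.
  have LZ k v : L (k *: v) = k *: L v.
    have dZ (p : 'rV[R]_d) : 'd f p (k *: v) = k *: 'd f p v by exact: linearZ.
    by rewrite [RHS]scalerBr; congr (_ - _); exact: dZ.
  have LB v : enorm (L v) <= (opnorm ('d f u) + opnorm ('d f x)) * enorm v.
    have eB (a b : 'rV[R]_d) p r : enorm a = p -> enorm b = r ->
      enorm (a - b) <= p + r by move=> <- <-; exact: ler_enormB.
    by rewrite mulrDl; exact: eB (fsim u Vu v) (fsim x Vxx v).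
  apply: (le_trans (enorm_le_opnorm L _ (y - z) LZ LB)).
  apply: ler_wpM2r; first exact: enorm_ge0.
  apply: (le_trans (fC u x Vu Vxx)).
  apply: (@le_trans _ _ (`|C0| * enorm (u - x) `^ eps)).
    by rewrite ler_wpM2r ?powR_ge0// ler_norm.
  apply: ler_wpM2l => //; apply: ge0_ler_powR => //; first exact: ltW.
  by rewrite nnegrE enorm_ge0.
rewrite -(fsim x Vxx (y - z)); move: ('d f x (y - z)) main => e main.
rewrite ler_norml; apply/andP; split.
  by have := ler_enormB (f y - f z) (f y - f z - e); rewrite subKr; lra.
by have := ler_enormD (f y - f z - e) e; rewrite subrK; lra.
Qed.

End ConformalMaps.

(** * The limit set, and distortion bounds for one map of a CIFS *)

Section LimitSet.
Context {R : realType} {d : nat} {I : Type}.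
Implicit Types (X : set 'rV[R]_d) (S : I -> 'rV[R]_d -> 'rV[R]_d).

Lemma limit_set_subset X S : (forall i x, X x -> X (S i x)) ->
  limit_set X S `<=` X.
Proof. by move=> SX x [w _ /(_ 1 isT)[y Xy <-]]; exact: SX. Qed.

Lemma limit_set_invariant X S i x : (forall i x, X x -> X (S i x)) ->
  limit_set X S x -> limit_set X S (S i x).
Proof.
move=> SX Fx; have Xx := limit_set_subset _ _ SX _ Fx.
have [w _ wx] := Fx; pose w' k := if k is k'.+1 then w k' else i.
exists w' => // -[//|n] _.
have -> : mkseq w' n.+1 = i :: mkseq w n.
  by rewrite /mkseq /= -[1%N]addn0 iotaDl -map_comp.
(* For the one-letter word the coding of [x] gives no information, as its condition starts at length
   one; [x] itself is the preimage in [X]. *)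
case: n => [|n]; first by exists x.
by have [y Xy yx] := wx n.+1 isT; exists y => //=; rewrite -yx.
Qed.

End LimitSet.

(** Here [J] is the norm of the derivative of the extended map: conformality bounds it above by
    [xi], bounded distortion bounds it away from zero. *)
Lemma cifs_iter_bilipschitz {R : realType} {d : nat} {I : Type}
    (X : set 'rV[R]_d) (S : I -> 'rV[R]_d -> 'rV[R]_d) (i : I) : CIFS X S ->
  exists (J : 'rV[R]_d -> R) (m xi eta : R),
    [/\ 0 < m, xi < 1, 0 < eta,
        forall x, X x -> m <= J x <= xi &
        forall x y z, X x -> X y -> X z ->
          enorm (y - x) <= eta -> enorm (z - x) <= eta -> forall n,
          orbit_prod (S i) J n x / 2 * enorm (y - z)
            <= enorm (iter n (S i) y - iter n (S i) z)
            <= 2 * orbit_prod (S i) J n x * enorm (y - z)].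
Proof.
move=> [_ cX _ _ _ SX [[x0 /interior_subset Xx0] _ _] _ [V [eps [f [[]]]]]].
move=> [oV _ _ XV] eps0 fV [xi /andP[xi0 xi1] fxi] [K K0 fK].
have [fS _ _ _ fconf] := fV i.
have {}fxi u : V u -> opnorm ('d (f i) u) < xi.
  move=> Vu; rewrite -lte_fin; apply: le_lt_trans (fxi i).
  by apply: ereal_sup_ubound; exists u.
have fpos := conformal_opnorm_gt0 _ _ _ x0 fconf (XV _ Xx0).
have [delta delta0 Xdelta] := compact_eball_subset X V cX oV XV.
have [C C0 fC] := conformal_almost_similar _ _ _ eps0 fconf.
pose J x := opnorm ('d (f i) x).
(* Bounded distortion for the one-letter word [[:: i]] compares every point of [X] with the fixed
   point of reference [x0]. *)
have Jm x : X x -> opnorm ('d (f i) x0) / K <= J x.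
  move=> Xx; rewrite ler_pdivrMr// mulrC.
  exact: (fK [:: i] isT x x0 (XV _ Xx) (XV _ Xx0)).
have inV x t u : X x -> t < delta -> enorm (u - x) <= t -> V u.
  by move=> Xx td ux; apply: (Xdelta _ Xx); exact: le_lt_trans td.
have [|x y Xx Xy yx|x y z t Xx Xy Xz td yx zx|eta eta0 bil] :=
    @iter_bilipschitz _ _ X (S i) J (opnorm ('d (f i) x0) / K) xi eps C delta
    (divr_gt0 fpos K0) _ eps0 C0 delta0 (SX i) Jm.
- by rewrite xi0 xi1.
(* [X] may fail to be convex, but the segment from [x] to [y] stays in the [delta]-ball around [x],
   which lies in [V]. *)
- rewrite -!fS//; apply: (conformal_lipschitz eps _ _ V) => // [u Vu|t t01].
    exact/ltW/fxi.
  apply: (inV x (enorm (y - x))) => //; apply: enorm_segment => //.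
  by rewrite subrr enorm0 enorm_ge0.
- by rewrite -!fS//; apply: fC => // u; exact: inV.
exists J, (opnorm ('d (f i) x0) / K), xi, eta; split => //.
  exact: divr_gt0.
by move=> x Xx; rewrite Jm//= ltW// fxi//; exact: XV.
Qed.

(** * Blowing down covers and comparing the spectra *)

Section AssouadSpectrum.
Context {R : realType} {d : nat}.
Implicit Types (E : set 'rV[R]_d) (T : 'rV[R]_d -> 'rV[R]_d)
  (J : 'rV[R]_d -> R).

Lemma orbit_prod_le_exp E T J (m xi : R) x n : 0 < m ->
  (forall y, E y -> E (T y)) -> (forall y, E y -> m <= J y <= xi) -> E x ->
  0 < orbit_prod T J n x <= xi ^+ n.
Proof.
move=> m0 TE Jb Ex; elim: n => [|n /andP[a0 an]].
  by rewrite /orbit_prod big_ord0 ltr01 lexx.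
have /andP[mJ Jxi] := Jb _ (iter_closed E T n x TE Ex).
have J0 := lt_le_trans m0 mJ.
by rewrite orbit_prodS mulr_gt0//= exprSr ler_pM// ltW.
Qed.

(* The least [n] with [2 a_n <= sigma] makes [T^n] contract by a factor
   comparable to [sigma], since consecutive [a_n] differ by a factor at least
   [m]. *)
Lemma covering_number_blowdown E T J (m xi eta : R) :
  0 < m -> xi < 1 ->
  (forall x, E x -> E (T x)) -> (forall x, E x -> m <= J x <= xi) ->
  (forall x y z, E x -> E y -> E z ->
     enorm (y - x) <= eta -> enorm (z - x) <= eta -> forall n,
     orbit_prod T J n x / 2 * enorm (y - z)
       <= enorm (iter n T y - iter n T z)
       <= 2 * orbit_prod T J n x * enorm (y - z)) ->
  forall x rho sigma r, E x -> 0 < rho <= eta -> 0 < sigma <= 1 ->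
  exists2 x', E x' &
    (covering_number r (eball x rho `&` E)
     <= covering_number (m / 8 * sigma * r) (eball x' (sigma * rho) `&` E))%E.
Proof.
move=> m0 xi1 TE Jb bil x rho sigma r Ex /andP[rho0 rhoeta] /andP[s0 s1].
pose a n := orbit_prod T J n x.
have aP n : 0 < a n <= xi ^+ n :=
  orbit_prod_le_exp E T J m xi x n m0 TE Jb Ex.
have [n n_s n_min] : exists2 n, 2 * a n <= sigma &
    forall k, 2 * a k <= sigma -> (n <= k)%N.
  have exn : exists n, 2 * a n <= sigma.
    have /andP[mJ Jxi] := Jb x Ex; have xi0 := lt_le_trans m0 (le_trans mJ Jxi).
    have /cvgr0_norm_lt xicvg : (fun n => xi ^+ n) @ \oo --> 0.
      by apply: cvg_expr; rewrite gtr0_norm.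
    have /filter_ex[n] : \forall n \near \oo, `|xi ^+ n| < sigma / 2.
      by apply: xicvg; rewrite divr_gt0.
    rewrite ger0_norm ?exprn_ge0 ?(ltW xi0)// => xin; exists n.
    by have /andP[_ an] := aP n; lra.
  by exists (ex_minn exn); case: ex_minnP => // k ? kmin.
have a_s : m * sigma < 2 * a n.
  case: n n_s n_min => [|n] n_s n_min.
    (* The case [n = 0] is impossible: the empty product is 1, while [sigma <= 1]. *)
    by move: n_s; rewrite /a /orbit_prod big_ord0; lra.
  have an : sigma < 2 * a n by rewrite ltNge; apply/negP => /n_min; rewrite ltnn.
  have /andP[mJ _] := Jb _ (iter_closed E T n x TE Ex).
  rewrite /a orbit_prodS -/(a n) mulrA [_ * J _]mulrC.
  by apply: (@lt_le_trans _ _ (m * (2 * a n))); rewrite ?ltr_pM2l// ler_pM2r// (lt_trans s0).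
have /andP[an0 _] := aP n.
have inball y : eball x rho y -> enorm (y - x) <= eta.
  by move=> /ltW yx; exact: le_trans rhoeta.
exists (iter n T x); first exact: iter_closed.
apply: (@covering_number_expanding _ _ _ _ _ _ (iter n T)).
  move=> y [yx Ey]; split; last exact: iter_closed.
  have xx : enorm (x - x) <= eta by rewrite subrr enorm0 ltW// (lt_le_trans rho0).
  have /andP[_] := bil x y x Ex Ey Ex (inball _ yx) xx n.
  move=> up; apply: (le_lt_trans up).
  apply: (@le_lt_trans _ _ (sigma * enorm (y - x))).
    by rewrite ler_wpM2r// enorm_ge0.
  by rewrite ltr_pM2l.
(* The 8 in [m / 8] collects three factors 2: from the diameter of a ball, from the lower
   bi-Lipschitz bound and from [a_s]. *)
move=> y z [yx Ey] [zx Ez] yz.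
have /andP[lo _] := bil x y z Ex Ey Ez (inball _ yx) (inball _ zx) n.
rewrite -(ltr_pM2l an0); rewrite -/(a n) in lo.
have r0 : 0 < r.
  have : 0 < 2 * (m / 8 * sigma * r) by exact: le_lt_trans (enorm_ge0 _) yz.
  by rewrite pmulr_rgt0// pmulr_rgt0// mulr_gt0// divr_gt0.
have : m * sigma * r < 2 * a n * r by rewrite ltr_pM2r.
lra.
Qed.

Lemma assouad_spectrum_monotone E X T J (m xi eta theta phi : R) :
  compact X -> E `<=` X -> 0 < m -> xi < 1 -> 0 < eta ->
  (forall x, E x -> E (T x)) -> (forall x, E x -> m <= J x <= xi) ->
  (forall x y z, E x -> E y -> E z ->
     enorm (y - x) <= eta -> enorm (z - x) <= eta -> forall n,
     orbit_prod T J n x / 2 * enorm (y - z)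
       <= enorm (iter n T y - iter n T z)
       <= 2 * orbit_prod T J n x * enorm (y - z)) ->
  0 < theta -> theta < phi -> phi < 1 ->
  (assouad_spectrum theta E <= assouad_spectrum phi E)%E.
Proof.
move=> cX EX m0 xi1 eta0 TE Jb bil theta0 thetaphi phi1.
have blow := covering_number_blowdown E T J m xi eta m0 xi1 TE Jb bil.
have phi0 : 0 < phi by exact: lt_trans thetaphi.
apply: le_ereal_inf => _ [alpha [C C0 phiC] <-]; exists alpha => //.
pose eta1 := Num.min eta 1.
have eta1_gt0 : 0 < eta1 by rewrite lt_min eta0 ltr01.
have [N XN] := covering_number_compact X (eta1 `^ (1 / theta)) cX
  (powR_gt0 _ eta1_gt0).
set u := 1 / phi - 1.
have u0 : 0 < u by rewrite subr_gt0 ltr_pdivlMr// mul1r.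
set v := 1 / theta - 1 / phi.
have v0 : 0 < v by rewrite subr_gt0 !div1r ltf_pV2.
set beta := alpha * (1 - 1 / theta).
pose C1 := C * (m / 8) `^ (- alpha).
pose C2 := N%:R * (eta1 `^ `|beta|)^-1.
have C1_gt0 : 0 < C1 by rewrite mulr_gt0 ?powR_gt0// divr_gt0.
have C2_ge0 : 0 <= C2 by rewrite mulr_ge0// invr_ge0 powR_ge0.
exists (C1 + C2); first by rewrite ltr_pwDl.
move=> x Ex rho /andP[rho0 rho1].
have [rhoeta|etarho] := leP rho eta1; last first.
  apply: (@le_trans _ _ (N%:R%:E)).
    apply: le_trans XN; apply: le_covering_number.
      apply: ge0_ler_powR; rewrite ?nnegrE ?(ltW etarho) ?(ltW rho0) ?(ltW eta1_gt0)//.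
      by rewrite divr_ge0// ltW.
    by move=> y [_ /EX].
  rewrite lee_fin; apply: (@le_trans _ _ (C2 * rho `^ beta)); last first.
    by rewrite ler_wpM2r ?powR_ge0// lerDr ltW.
  rewrite /C2 -mulrA ler_peMr// mulrC ler_pdivlMr ?powR_gt0// mul1r.
  apply: (@le_trans _ _ (rho `^ `|beta|)).
    by apply: ge0_ler_powR; rewrite ?nnegrE ?(ltW etarho) ?(ltW rho0) ?(ltW eta1_gt0).
  by apply: ger_powR; rewrite ?rho0// ler_norm.
have [rho_eta _] : rho <= eta /\ rho <= 1 by move: rhoeta; rewrite le_min => /andP[].
have m1 : m / 8 <= 1.
  by have /andP[mJ Jxi] := Jb x Ex; have := le_trans mJ Jxi; lra.
have m8 : 0 < m / 8 by rewrite divr_gt0.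
(* This solves [(sigma * rho)]^ (1 / phi) = m / 8 * sigma * rho [^ (1 / theta)]: the scale required
   for [phi] at radius [sigma * rho] is exactly the one delivered by the blow-down. *)
pose sigma := (m / 8 * rho `^ v) `^ u^-1.
have sigmau : sigma `^ u = m / 8 * rho `^ v.
  by rewrite /sigma -powRrM mulVf ?gt_eqF// powRr1// mulr_ge0 ?powR_ge0// ltW.
have sigma0 : 0 < sigma by rewrite powR_gt0// mulr_gt0// powR_gt0.
have rhov1 : rho `^ v <= 1.
  by have := @ger_powR R rho (introT andP (conj rho0 rho1)) _ _ (ltW v0); rewrite powRr0.
have base1 : m / 8 * rho `^ v <= 1 by rewrite -[leRHS]mulr1 ler_pM ?powR_ge0// ltW.
have sigma1 : sigma <= 1.
  have := @ge0_ler_powR R u^-1 _ (m / 8 * rho `^ v) 1; rewrite powR1; apply => //.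
  - by rewrite invr_ge0 ltW.
  - by rewrite nnegrE mulr_ge0 ?powR_ge0// ltW.
  - by rewrite nnegrE.
have [x' Ex' xx'] := blow x rho sigma (rho `^ (1 / theta)) Ex
  (introT andP (conj rho0 rho_eta)) (introT andP (conj sigma0 sigma1)).
have sr0 : 0 < sigma * rho by rewrite mulr_gt0.
have sr1 : sigma * rho <= 1 by rewrite -[leRHS]mulr1 ler_pM// ltW.
have pD (y p q : R) : 0 < y -> y `^ (p + q) = y `^ p * y `^ q.
  by move=> y0; rewrite powRD// (gt_eqF y0)/= implybT.
have scale : (sigma * rho) `^ (1 / phi) = m / 8 * sigma * rho `^ (1 / theta).
  have -> : (sigma * rho) `^ (1 / phi) = sigma `^ (u + 1) * rho `^ (1 / phi).
    by rewrite powRM ?(ltW sigma0) ?(ltW rho0)// subrK.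
  have -> : rho `^ (1 / theta) = rho `^ (v + 1 / phi) by rewrite subrK.
  rewrite (pD sigma u)// (pD rho v)// sigmau powRr1 ?(ltW sigma0)//; ring.
apply: (le_trans xx'); rewrite -scale.
apply: (le_trans (phiC x' Ex' (sigma * rho) (introT andP (conj sr0 sr1)))).
rewrite lee_fin; apply: (@le_trans _ _ (C1 * rho `^ beta)); last first.
  by rewrite ler_wpM2r ?powR_ge0// lerDl.
have sru : (sigma * rho) `^ u = m / 8 * rho `^ (1 / theta - 1).
  have -> : 1 / theta - 1 = v + u by rewrite /u /v; ring.
  by rewrite powRM ?(ltW sigma0) ?(ltW rho0)// sigmau (pD rho v)// mulrA.
(* Both exponents are written as multiples of [- alpha], so that the identity [sru] between the
   bases can be raised to that power. *)
have -> : alpha * (1 - 1 / phi) = u * - alpha by rewrite /u; ring.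
have -> : beta = (1 / theta - 1) * - alpha by rewrite /beta; ring.
rewrite powRrM sru powRM ?powR_ge0 ?(ltW m8)// -powRrM /C1.
by rewrite -!mulrA.
Qed.

End AssouadSpectrum.

Theorem lemma4p2 (R : realType) (d : nat) (I : Type) (X : set 'rV[R]_d)
    (S : I -> 'rV[R]_d -> 'rV[R]_d) (hS : CIFS X S)
    (theta phi : R) (htheta : 0 < theta) (hlt : theta < phi) (hphi : phi < 1) :
  (assouad_spectrum theta (limit_set X S)
   <= assouad_spectrum phi (limit_set X S))%E.
Proof.
have [i _] := cifs_index_nonempty hS.
have SX := cifs_maps hS; have FX := limit_set_subset X S SX.
have [J [m [xi [eta [m0 xi1 eta0 Jb bil]]]]] := cifs_iter_bilipschitz X S i hS.
apply: (@assouad_spectrum_monotone _ _ _ X (S i) J m xi eta) => //.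
- exact: cifs_compact hS.
- by move=> x; exact: limit_set_invariant.
- by move=> x /FX; exact: Jb.
- by move=> x y z /FX Xx /FX Xy /FX Xz; exact: bil.
Qed.
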